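(* For each integer $n\ge 2$ and every integer $r\ge 2$, $$\#\mathrm{col}_r\,T(2,n)=(n,r)\,r .$$
   Context: $(n,r)$ is the greatest common divisor of $n$ and $r$. $T(2,n)$ is the torus link (a knot for odd $n$, a two-component link for even $n$) obtained as the closure of the two-strand braid $\sigma_1^n$, $\sigma_1\in B_2$. An $r$-coloring (Fox coloring) of a link diagram is an assignment of an element of $\mathbb{Z}_r=\mathbb{Z}/r\mathbb{Z}$ to each arc of the diagram such that at each crossing the sum of the elements at the two under-arcs minus twice the element at the over-arc is $0$ mod $r$. The number of $r$-colorings does not depend on the diagram chosen for a link $K$ (it is invariant under Reidemeister moves), and is denoted $\#\mathrm{col}_r K$. *)

(* Defs.v *)
From HB Require Import structures.
From mathcomp Require Import all_boot all_order all_algebra.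

Set Implicit Arguments.
Unset Strict Implicit.
Unset Printing Implicit Defensive.

Import GRing.Theory.

(* Combinatorial data of a link diagram: finitely many marked points on its
   strands, such that every arc carries at least one of them.
   [joined d p q] means that some piece of strand runs from p to q without
   passing under another strand. At the crossing x, [over x] lies on the
   over-strand, and [under_in x], [under_out x] lie on the two sides of the
   under-strand.  Planarity plays no role for colorings and is not recorded. *)
Record link_diagram := LinkDiagram {
  point : finType;
  joined : rel point;
  crossing : finType;
  over : crossing -> point;
  under_in : crossing -> point;
  under_out : crossing -> point
}.

Section Colorings.
Variable D : link_diagram.

Definition same_arc : rel (point D) :=
  connect (fun p q => joined p q || joined q p).

Definition arc_set (p : point D) : {set point D} := [set q | same_arc p q].

Definition arcs : {set {set point D}} := [set arc_set p | p in point D].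

Definition arc := {A : {set point D} | A \in arcs}.

Definition arc_of (p : point D) : arc :=
  exist _ (arc_set p) (imset_f arc_set (isT : p \in point D)).

Local Open Scope ring_scope.

(* 'Z_r is Z/rZ only for r >= 2. *)
Definition fox_coloring (r : nat) (c : {ffun arc -> 'Z_r}) : bool :=
  [forall x : crossing D,
     c (arc_of (under_in x)) + c (arc_of (under_out x))
       - c (arc_of (over x)) *+ 2 == 0].

Definition num_col (r : nat) : nat :=
  #|[set c : {ffun arc -> 'Z_r} | fox_coloring c]|.

End Colorings.

(* A braid word on m.+1 strands, read from bottom to top; the strand positions
   are 0, ..., m.  The letter (i, true) exchanges positions i and i+1, the
   strand going from i to i+1 passing over; (i, false) is its inverse, where
   the strand going from i+1 to i passes over. *)
Definition braid_word (m : nat) := seq ('I_m * bool).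

Section Closure.
Variables (m : nat) (w : braid_word m).

(* The point (k, j) sits at position j just below the k-th letter of w, and
   just above the last letter if k = size w. *)
Definition braid_point : finType := ('I_(size w).+1 * 'I_m.+1)%type.

Definition letter (k : 'I_(size w)) : 'I_m * bool := tnth (in_tuple w) k.

Definition below (k : 'I_(size w)) (j : 'I_m.+1) : braid_point :=
  (widen_ord (leqnSn _) k, j).
Definition above (k : 'I_(size w)) (j : 'I_m.+1) : braid_point :=
  (lift ord0 k, j).

Definition pos_left (i : 'I_m) : 'I_m.+1 := widen_ord (leqnSn m) i.
Definition pos_right (i : 'I_m) : 'I_m.+1 := lift ord0 i.

Definition over_start (a : 'I_m * bool) : 'I_m.+1 :=
  if a.2 then pos_left a.1 else pos_right a.1.
Definition over_end (a : 'I_m * bool) : 'I_m.+1 :=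
  if a.2 then pos_right a.1 else pos_left a.1.

(* The three cases: the over-strand of a letter, a strand not involved in a
   letter, and a closing strand. *)
Definition braid_joined (p q : braid_point) : bool :=
  [|| [exists k : 'I_(size w),
         (p == below k (over_start (letter k)))
           && (q == above k (over_end (letter k)))],
      [exists k : 'I_(size w), exists j : 'I_m.+1,
         [&& j != pos_left (letter k).1, j != pos_right (letter k).1,
             p == below k j & q == above k j]]
    | [exists j : 'I_m.+1, (p == (ord_max, j)) && (q == (ord0, j))]].

(* The under-strand of a letter starts where its over-strand ends, and ends
   where its over-strand starts. *)
Definition braid_closure : link_diagram :=
  {| point := braid_point;
     joined := braid_joined;
     crossing := 'I_(size w);
     over := fun k => below k (over_start (letter k));
     under_in := fun k => below k (over_end (letter k));
     under_out := fun k => above k (over_start (letter k)) |}.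

End Closure.

(* T(2, n), the closure of the n-th power of the generator of B_2. *)
Definition torus_link_2 (n : nat) : link_diagram :=
  @braid_closure 1 (nseq n (ord0, true)).

(* Main.v *)
(* Colour the point at height k and position j of the closed two-strand braid
   by f(k, j).  The over-strand gives f(k+1, 1) = f(k, 0), and the crossing
   relation f(k+1, 0) = 2 f(k, 0) - f(k, 1), so that f(k, j) = a + (k - j) d
   with a = f(0, 0) and d = f(0, 0) - f(0, 1).  Closing the braid imposes
   exactly n d = 0, which has gcd(n, r) solutions d in Z/rZ, while a is free. *)
Require Import Defs.
From mathcomp Require Import all_boot all_order all_algebra.
From mathcomp Require Import ring.

Set Implicit Arguments.
Unset Strict Implicit.
Unset Printing Implicit Defensive.

Import GRing.Theory.

Section ArcFunctions.
Variable D : link_diagram.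

Lemma arc_of_surj (A : Defs.arc D) : exists p, A = arc_of p.
Proof.
by case: A => A PA; case/imsetP: (PA) => p _ eqA; exists p; apply: val_inj.
Qed.

Lemma same_arc_sym : symmetric (@same_arc D).
Proof. by apply: sym_connect_sym => p q; rewrite orbC. Qed.

Lemma arc_of_joined (p q : point D) : joined p q -> arc_of p = arc_of q.
Proof.
move=> pq; apply: val_inj; apply/setP=> s; rewrite !inE.
apply: (same_connect same_arc_sym); apply: connect1; by rewrite pq.
Qed.

(** Arcs are the classes of the equivalence generated by [joined], so [f] descends to them. This
    lets a coloring be defined by a formula on points. *)
Lemma arc_function_exists (T : Type) (f : point D -> T) :
    (forall p q, joined p q -> f p = f q) ->
  exists c : {ffun Defs.arc D -> T}, forall p, c (arc_of p) = f p.
Proof.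
move=> fJ.
have surj (A : Defs.arc D) : exists p, A == arc_of p
  by have [p ->] := arc_of_surj A; exists p.
pose rep A := xchoose (surj A).
have {}fJ p q : same_arc p q -> f p = f q.
  case/connectP=> s + ->; elim: s p => //= p' s IH p /andP[pp' /IH <-].
  by case/orP: pp' => /fJ.
exists [ffun A => f (rep A)] => p; rewrite ffunE; apply/esym/fJ.
(* The arcs of [p] and of its chosen representative agree as sets, and the representative lies in
   its own arc, hence in that of [p]. *)
have /eqP/(congr1 val)/setP/(_ (rep (arc_of p))) := xchooseP (surj (arc_of p)).
by rewrite !inE -/(rep _) => ->; apply: connect0.
Qed.

End ArcFunctions.

Section TwoStrandTorusLink.
Variable n : nat.

Let w : braid_word 1 := nseq n (ord0, true).

Lemma letter_nseq k : letter (w := w) k = (ord0, true).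
Proof. by have /nseqP[] := mem_tnth k (in_tuple w). Qed.

Lemma pos_left_ord0 : pos_left (ord0 : 'I_1) = ord0.
Proof. exact: val_inj. Qed.

Lemma pos_right_ord0 : pos_right (ord0 : 'I_1) = ord_max.
Proof. exact: val_inj. Qed.

Definition posE :=
  (letter_nseq, pos_left_ord0, pos_right_ord0).

Lemma torus_joined_over (k : 'I_(size w)) :
  @joined (torus_link_2 n) (below k ord0) (above k ord_max).
Proof.
apply/or3P/Or31/existsP; exists k.
by rewrite /over_start /over_end !posE /= !eqxx.
Qed.

Lemma torus_joined_closing (j : 'I_2) :
  @joined (torus_link_2 n) (ord_max, j) (ord0, j).
Proof. by apply/or3P/Or33/existsP; exists j; rewrite !eqxx. Qed.

Lemma ord2P (P : 'I_2 -> Prop) : P ord0 -> P ord_max -> forall j, P j.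
Proof.
move=> P0 P1 [[|[|//]] lt_j].
- by rewrite (_ : Ordinal _ = ord0) //; apply: val_inj.
- by rewrite (_ : Ordinal _ = ord_max) //; apply: val_inj.
Qed.

Lemma torus_joinedP (p q : point (torus_link_2 n)) : joined p q ->
  (exists k : 'I_(size w), p = below k ord0 /\ q = above k ord_max) \/
  (exists j, p = (ord_max, j) /\ q = (ord0, j)).
Proof.
case/or3P=> /existsP[k].
- rewrite /over_start /over_end !posE /= => /andP[/eqP-> /eqP->].
  by left; exists k.
(* With two strands, every letter involves both positions, so no strand is left aside. *)
- by case/existsP; apply: ord2P; rewrite !posE.
- by case/andP=> /eqP-> /eqP->; right; exists k.
Qed.

Local Open Scope ring_scope.

Lemma fox_coloring_torusP r (c : {ffun Defs.arc (torus_link_2 n) -> 'Z_r}) :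
  reflect (forall k : 'I_(size w),
     c (arc_of (below k ord_max : point (torus_link_2 n)))
       + c (arc_of (above k ord0 : point (torus_link_2 n)))
     = c (arc_of (below k ord0 : point (torus_link_2 n))) *+ 2)
   (fox_coloring c).
Proof.
apply: (iffP forallP) => H k; have := H k;
  rewrite /= /over_start /over_end !posE /= => E.
- exact/eqP/(etrans _ E)/esym/subr_eq0.
- by rewrite subr_eq0 E.
Qed.

Definition torus_color r (a d : 'Z_r) (p : point (torus_link_2 n)) : 'Z_r :=
  a + d *+ p.1 - d *+ p.2.

Lemma torus_colorE r (c : {ffun Defs.arc (torus_link_2 n) -> 'Z_r}) :
    fox_coloring c ->
  let a := c (arc_of ((ord0, ord0) : point (torus_link_2 n))) in
  let b := c (arc_of ((ord0, ord_max) : point (torus_link_2 n))) in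
  forall p, c (arc_of p) = torus_color a (a - b) p.
Proof.
move=> /fox_coloring_torusP cF a b [[k lt_k] j]; elim: k lt_k j => [|k IH] lt_k.
  rewrite (_ : Ordinal lt_k = ord0); last exact: val_inj.
  by apply: ord2P; rewrite /torus_color /= ?mulr0n ?mulr1n -/a -/b; ring.
pose k' : 'I_(size w) := Ordinal (lt_k : (k < size w)%N).
have above_k' j : above k' j = (Ordinal lt_k, j).
  by congr pair; apply: val_inj.
have below_k' j : below k' j = (Ordinal (ltnW lt_k), j).
  by congr pair; apply: val_inj.
have colorE j : c (arc_of (below k' j : point (torus_link_2 n))) =
    a + (a - b) *+ k - (a - b) *+ j by rewrite below_k' IH.
apply: ord2P; rewrite -above_k' /torus_color /=.
(* Position 0 is where the under-strand leaves: its color comes from the crossing relation. *)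
- have := cF k'; rewrite !colorE /= => /(canRL (addKr _)) ->.
  rewrite /bump /= add1n mulrS mulr0n; ring.
(* Position 1 is reached by the over-strand, which keeps the color it had at position 0 below. *)
- rewrite -(arc_of_joined (torus_joined_over k')) colorE /=.
  rewrite /bump /= add1n mulrS mulr0n; ring.
Qed.

(** An over-strand raises height and position by one each, preserving their difference; only the
    closing strands, from height [n] to height 0, require [d *+ n = 0]. *)
Lemma torus_color_joined r (a d : 'Z_r) (p q : point (torus_link_2 n)) :
  d *+ n = 0 -> joined p q -> torus_color a d p = torus_color a d q.
Proof.
move=> dn0 /torus_joinedP[[k [-> ->]]|[j [-> ->]]]; rewrite /torus_color /=.
- rewrite /bump /= add1n mulrS mulr0n; ring.
- by rewrite size_nseq dn0.
Qed.

Lemma num_col_torus r :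
  num_col (torus_link_2 n) r = (#|'Z_r| * #|[set d : 'Z_r | d *+ n == 0]%R|)%N.
Proof.
pose pt j : point (torus_link_2 n) := (ord0, j).
pose h (c : {ffun Defs.arc (torus_link_2 n) -> 'Z_r}) :=
  (c (arc_of (pt ord0)), c (arc_of (pt ord0)) - c (arc_of (pt ord_max))).
rewrite /num_col -cardsT -cardsX.
(* [h] is injective on colorings, since the two colors at height 0 determine all others; it remains
   to identify its image. *)
rewrite -(card_in_imset (f := h)) => [|c c']; last first.
  rewrite !inE /h => cF cF' /eqP; rewrite xpair_eqE => /andP[/eqP Ea /eqP Ed].
  apply/ffunP => A.
  have [p ->] := arc_of_surj A.
  rewrite (torus_colorE cF) (torus_colorE cF').
  by rewrite -/(pt ord0) -/(pt ord_max) Ed Ea.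
apply: eq_card => -[a d]; rewrite !inE /=; apply/imsetP/eqP => [[c]|dn0].
  rewrite inE => cF [_ ->].
  (* The closing strand at position 0 gives [a + d *+ n = a]. *)
  have := arc_of_joined (torus_joined_closing ord0) => /(congr1 c).
  rewrite [LHS](torus_colorE cF) /torus_color /= mulr0n subr0.
  rewrite [X in _ *+ X]size_nseq.
  by move/(canRL (addKr _)); rewrite addNr.
have [c cE] := arc_function_exists
  (fun p q => @torus_color_joined r a d p q dn0).
exists c.
  rewrite inE; apply/fox_coloring_torusP => k; rewrite !cE /torus_color /=.
  rewrite /bump /= add1n mulrS mulr0n; ring.
by rewrite /h !cE /torus_color /=; congr pair; rewrite !mulr0n; ring.
Qed.

End TwoStrandTorusLink.

(** With [g = gcdn n r], the condition on [d] amounts to divisibility by [r %/ g], and the solutions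
    are the multiples [i * (r %/ g)] with [i < g]. *)
Lemma card_Zp_torsion n r : 1 < r ->
  #|[set d : 'Z_r | d *+ n == 0]%R| = gcdn n r.
Proof.
case: r => [|[|r]] // _; set R := r.+2; set g := gcdn n R.
have g_gt0 : 0 < g by rewrite gcdn_gt0 orbT.
have gR : R = R %/ g * g by rewrite divnK ?dvdn_gcdr.
have q_gt0 : 0 < R %/ g by rewrite divn_gt0 // dvdn_leq ?dvdn_gcdr.
have lt_iR (i : 'I_g) : i * (R %/ g) < R.
  by rewrite [X in _ < X]gR mulnC ltn_pmul2l.
pose h (i : 'I_g) : 'Z_R := Ordinal (lt_iR i).
rewrite -[RHS]card_ord -cardsT -(card_imset (f := h)); last first.
  by move=> i j [/eqP]; rewrite eqn_pmul2r // => /eqP/val_inj.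
have torsionE (d : 'Z_R) : (d *+ n == 0)%R = (R %/ g %| d).
  rewrite -val_eqE Zp_mulrn /= -/(dvdn R _).
  (* [d * g] is the gcd of [d * n] and [d * R], and [R] always divides the latter. *)
  have -> : (R %| d * n) = (R %| d * g).
    by rewrite /g muln_gcdr dvdn_gcd (dvdn_mull d (dvdnn R)) andbT.
  by rewrite [X in X %| _]gR dvdn_pmul2r.
apply: eq_card => d; rewrite inE torsionE; apply/idP/imsetP => [/dvdnP[i di]|].
  have lt_ig : i < g.
    by rewrite -(ltn_pmul2r q_gt0) -di [X in _ < X]mulnC -gR ltn_ord.
  by exists (Ordinal lt_ig); rewrite ?inE //; apply: val_inj.
by case=> i _ ->; apply: dvdn_mull.
Qed.

Theorem proposition2p1 (n r : nat) (hn : 2 <= n) (hr : 2 <= r) :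
  num_col (torus_link_2 n) r = gcdn n r * r.
Proof.
by rewrite num_col_torus card_Zp_torsion // card_ord Zp_cast // mulnC.
Qed.
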